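(* Let $\mathcal{A}$ be an associative conformal algebra, $M$ a conformal $\mathcal{A}$-bimodule, and $T:M\to\mathcal{A}$ a $\mathbb{C}[\partial]$-module homomorphism. Then $T$ is an $\mathcal{O}$-operator on $\mathcal{A}$ with respect to $M$ if and only if its graph $Gr(T)=\{(T(m),m)\mid m\in M\}$ is a subalgebra of the semi-direct product associative conformal algebra $\mathcal{A}\oplus_0 M$.
   Context: All vector spaces are over $\mathbb{C}$. For $\mathbb{C}[\partial]$-modules $U,V,W$, a $\mathbb{C}$-bilinear map $U\times V\to W[\lambda]$, $(u,v)\mapsto u_\lambda v$, is conformal sesquilinear if $(\partial u)_\lambda v=-\lambda\, u_\lambda v$ and $u_\lambda(\partial v)=(\partial+\lambda)(u_\lambda v)$. Maps are extended coefficientwise to polynomials. An associative conformal algebra is a $\mathbb{C}[\partial]$-module $\mathcal{A}$ with a conformal sesquilinear map $(a,b)\mapsto a_\lambda b\in\mathcal{A}[\lambda]$ with $(a_\lambda b)_{\lambda+\mu}c=a_\lambda(b_\mu c)$. A subalgebra is a $\mathbb{C}[\partial]$-submodule $B$ with $x_\lambda y\in B[\lambda]$ for $x,y\in B$. A conformal $\mathcal{A}$-bimodule is a $\mathbb{C}[\partial]$-module $M$ with conformal sesquilinear maps $(a,m)\mapsto a_\lambda m\in M[\lambda]$ and $(m,a)\mapsto m_\lambda a\in M[\lambda]$ such that $(a_\lambda b)_{\lambda+\mu}m=a_\lambda(b_\mu m)$, $(m_\lambda a)_{\lambda+\mu}b=m_\lambda(a_\mu b)$, $(a_\lambda m)_{\lambda+\mu}b=a_\lambda(m_\mu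 b)$. An $\mathcal{O}$-operator on $\mathcal{A}$ with respect to $M$ is a $\mathbb{C}[\partial]$-module homomorphism $T:M\to\mathcal{A}$ with $T(m)_\lambda T(n)=T(T(m)_\lambda n+m_\lambda T(n))$ for all $m,n\in M$. $\mathcal{A}\oplus_0 M$ is the $\mathbb{C}[\partial]$-module $\mathcal{A}\oplus M$ with the associative $\lambda$-multiplication $(a,m)_\lambda(b,n)=(a_\lambda b,\;a_\lambda n+m_\lambda b)$. *)

(* Defs.v *)
From HB Require Import structures.
From mathcomp Require Import all_boot all_order all_algebra.
From mathcomp Require Import finmap boolp classical_sets reals.
From mathcomp Require Import complex monalg.

Set Implicit Arguments.
Unset Strict Implicit.
Unset Printing Implicit Defensive.
Import GRing.Theory.
Local Open Scope ring_scope.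

(* A K[∂]-module is an [lmodType {poly K}]: ∂ acts as [*:%R 'X] and a scalar c
   as [*:%R c%:P].

   W[λ] is [{malg W[nat]}], the finitely supported sequences of coefficients:
   << w *g i >> is λ^i w and p@_i is the coefficient of λ^i in p.  Only the
   additive group structure of W is needed to form it.  W[λ,μ] is (W[λ])[μ]:
   << << w *g i >> *g j >> is λ^i μ^j w. *)
Notation lpoly W := {malg W[nat]}.

Section LambdaPolynomials.
Variables U V W : zmodType.

(* coefficientwise extension of an additive map *)
Definition lmap (f : U -> W) (p : lpoly U) : lpoly W :=
  \sum_(i <- msupp p) << f p@_i *g i >>.

(* multiplication by λ *)
Definition lshift (p : lpoly W) : lpoly W :=
  \sum_(i <- msupp p) << p@_i *g i.+1 >>.

(* Given p = Σ_i λ^i p_i and x |-> f x ∈ W[ν], this is Σ_i λ^i (f p_i) at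
   ν = λ + μ, where
   λ^i (λ + μ)^k = Σ_(j <= k) 'C(k, j) λ^(i + (k - j)) μ^j. *)
Definition lmap_add (f : U -> lpoly W) (p : lpoly U) : lpoly (lpoly W) :=
  \sum_(i <- msupp p) \sum_(k <- msupp (f p@_i)) \sum_(j < k.+1)
    << << (f p@_i)@_k *+ 'C(k, j) *g (i + (k - j))%N >> *g (j : nat) >>.

(* (p, q) ∈ U[λ] × V[λ] as an element of (U × V)[λ] *)
Definition lpair (p : lpoly U) (q : lpoly V) : lpoly (U * V)%type :=
  \sum_(i <- msupp p) << (p@_i, 0) *g i >>
  + \sum_(i <- msupp q) << (0, q@_i) *g i >>.

End LambdaPolynomials.

(* Clauses 1, 2 (resp. 3, 4) are K-linearity in the first (resp. second)
   argument. *)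
Definition conformal_sesquilinear (K : fieldType) (U V W : lmodType {poly K})
    (f : U -> V -> lpoly W) : Prop :=
  [/\ forall u u' v, f (u + u') v = f u v + f u' v,
      forall c u v, f (c%:P *: u) v = lmap ( *:%R c%:P) (f u v),
      forall u v v', f u (v + v') = f u v + f u v' &
      forall c u v, f u (c%:P *: v) = lmap ( *:%R c%:P) (f u v)] /\
  [/\ forall u v, f ('X *: u) v = - lshift (f u v) &
      forall u v, f u ('X *: v) = lmap ( *:%R 'X) (f u v) + lshift (f u v)].

(* (u_λ v)_{λ+μ} w = u_λ (v_μ w) in X[λ,μ], for four possibly different
   products *)
Definition conformal_associative (K : fieldType)
    (U V W P Q X : lmodType {poly K})
    (uv : U -> V -> lpoly P) (pw : P -> W -> lpoly X)
    (vw : V -> W -> lpoly Q) (uq : U -> Q -> lpoly X) : Prop :=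
  forall u v w, lmap_add (pw^~ w) (uv u v) = lmap (uq u) (vw v w).

HB.mixin Record Lmodule_isAssocConformal (K : fieldType) A
    of GRing.Lmodule {poly K} A := {
  cmul : A -> A -> lpoly A;
  cmul_sesquilinear : conformal_sesquilinear cmul;
  cmulA : conformal_associative cmul cmul cmul cmul
}.

#[short(type="assocConformalType")]
HB.structure Definition AssocConformal (K : fieldType) :=
  {A of GRing.Lmodule {poly K} A & Lmodule_isAssocConformal K A}.

HB.mixin Record Lmodule_isConformalBimodule (K : fieldType)
    (A : assocConformalType K) M of GRing.Lmodule {poly K} M := {
  lact : A -> M -> lpoly M;
  ract : M -> A -> lpoly M;
  lact_sesquilinear : conformal_sesquilinear lact;
  ract_sesquilinear : conformal_sesquilinear ract;
  lactA : conformal_associative (@cmul K A) lact lact lact;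
  ractA : conformal_associative ract ract (@cmul K A) ract;
  lractA : conformal_associative lact ract ract lact
}.

#[short(type="conformalBimodType")]
HB.structure Definition ConformalBimodule (K : fieldType)
    (A : assocConformalType K) :=
  {M of GRing.Lmodule {poly K} M & Lmodule_isConformalBimodule K A M}.

Definition conformal_subalgebra (K : fieldType) (A : assocConformalType K)
    (B : set A) : Prop :=
  submod_closed [in B] /\
  (forall x y, x \in B -> y \in B -> cmul x y \is a monalgOver [in B]).

Definition O_operator (K : fieldType) (A : assocConformalType K)
    (M : conformalBimodType A) (T : {linear M -> A}) : Prop :=
  forall m n, cmul (T m) (T n) = lmap T (lact (T m) n + ract m (T n)).

Section CoefficientTheory.

Lemma mcoeff_lmap (U W : zmodType) (f : U -> W) p k :
  f 0 = 0 -> (lmap f p)@_k = f p@_k.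
Proof.
move=> f0; rewrite /lmap raddf_sum /=; have [kp|kNp] := msuppP p k.
  rewrite (big_fsetD1 k) //= mcoeffUU big1_fset ?addr0 // => i.
  by rewrite in_fsetD1 mcoeffU => /andP[/negPf-> _] _.
rewrite f0 big1_seq // => i /andP[_ ip]; rewrite mcoeffU.
by case: eqP ip kNp => // -> ->.
Qed.

Lemma mcoeff_lshift (W : zmodType) (p : lpoly W) k :
  (lshift p)@_k = if k is k'.+1 then p@_k' else 0.
Proof.
rewrite /lshift raddf_sum /=; case: k => [|k].
  by rewrite big1 // => i _; rewrite mcoeffU.
rewrite [in RHS](monalgE p) raddf_sum /=; apply: eq_bigr => i _.
by rewrite !mcoeffU eqSS.
Qed.

Lemma mcoeff_lpair (U V : zmodType) (p : lpoly U) (q : lpoly V) k :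
  (lpair p q)@_k = (p@_k, q@_k).
Proof.
rewrite mcoeffD -[X in X@_k + _]/(lmap (pair^~ 0) p).
rewrite -[X in _ + X@_k]/(lmap (pair 0) q) !mcoeff_lmap //.
by congr pair; rewrite /= ?addr0 ?add0r.
Qed.

Lemma msupp_sum1 (U X : zmodType) (p : lpoly U) n (F : nat -> X) :
  \sum_(k <- msupp p) (if k == n then F k else 0) =
  if n \in msupp p then F n else 0.
Proof.
have [np|nNp] := boolP (n \in msupp p).
  rewrite (big_fsetD1 n) //= eqxx big1_fset ?addr0 // => k.
  by rewrite in_fsetD1 => /andP[/negPf->].
by rewrite big1_seq // => k /andP[_ kp]; case: eqP kp nNp => // -> ->.
Qed.

Lemma mcoeff_lmap_add (U W : zmodType) (f : U -> lpoly W) p j s : f 0 = 0 ->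
  (lmap_add f p)@_j@_s =
  \sum_(i < s.+1) (f p@_(i : nat))@_(s - i + j)%N *+ 'C(s - i + j, j).
Proof.
move=> f0; rewrite /lmap_add !raddf_sum /=.
pose g (i : nat) := (f p@_i)@_(s - i + j)%N *+ 'C(s - i + j, j).
transitivity (\sum_(i <- msupp p) \sum_(h < s.+1) if i == h then g i else 0).
  apply: eq_bigr => i _; rewrite !raddf_sum /=.
  transitivity (\sum_(k <- msupp (f p@_i))
      (if (j <= k)%N && (i + (k - j) == s)%N
       then (f p@_i)@_k *+ 'C(k, j) else 0)).
    apply: eq_bigr => k _; rewrite !raddf_sum /=.
    have [jk|kj] := leqP j k; last first.
      rewrite big1 // => h _; rewrite mcoeffU.
      case: eqP => [hj|]; last by rewrite mcoeff0.
      by have := ltn_ord h; rewrite hj ltnS leqNgt kj.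
    rewrite (bigD1 (Ordinal (jk : (j < k.+1)%N))) //= mcoeffUU mcoeffU.
    rewrite big1 ?addr0 => [|h hj]; first by case: eqP.
    rewrite mcoeffU; case: eqP => [hE|]; last by rewrite mcoeff0.
    by case/eqP: hj; apply: val_inj.
  have [is_|si] := leqP i s; last first.
    rewrite !big1 // => k _.
      by case: eqP => // E; have := ltn_ord k; rewrite -E ltnS leqNgt si.
    by case: ifP => // /andP[_ /eqP E]; move: si; rewrite -E ltnNge leq_addr.
  have E k : ((j <= k) && (i + (k - j) == s))%N = (k == (s - i + j)%N).
    apply/andP/eqP => [[jk /eqP<-]|->]; first by rewrite addKn subnK.
    by rewrite leq_addl addnK subnKC.
  transitivity (\sum_(k <- msupp (f p@_i)) if k == (s - i + j)%N
      then (f p@_i)@_k *+ 'C(k, j) else 0).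
    by apply: eq_bigr => k _; rewrite -E.
  rewrite (msupp_sum1 _ _ (fun k => (f p@_i)@_k *+ 'C(k, j))).
  rewrite (bigD1 (Ordinal (is_ : (i < s.+1)%N))) //= eqxx big1 ?addr0.
    by rewrite /g; case: ifP => // /negbT /mcoeff_outdom ->; rewrite mul0rn.
  move=> h hi; case: eqP => // ih; case/eqP: hi; exact: val_inj.
rewrite exchange_big /=; apply: eq_bigr => h _.
rewrite msupp_sum1 /g; case: ifP => // /negbT /mcoeff_outdom ->.
by rewrite f0 mcoeff0 mul0rn.
Qed.

End CoefficientTheory.

Section Sesquilinear.
Variables (K : fieldType) (U V W : lmodType {poly K}) (f : U -> V -> lpoly W).
Hypothesis ff : conformal_sesquilinear f.

Lemma sesq0l v : f 0 v = 0.
Proof.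
by case: ff => -[fD _ _ _] _; apply: (addrI (f 0 v)); rewrite -fD !addr0.
Qed.

Lemma sesq0r u : f u 0 = 0.
Proof.
by case: ff => -[_ _ fD _] _; apply: (addrI (f u 0)); rewrite -fD !addr0.
Qed.
End Sesquilinear.

Definition semidirect (K : fieldType) (A : assocConformalType K)
  (M : conformalBimodType A) : Type := (A * M)%type.

Section Semidirect.
Variables (K : fieldType) (A : assocConformalType K) (M : conformalBimodType A).

HB.instance Definition _ := GRing.Lmodule.on (semidirect M).

Definition semidirect_mul (x y : semidirect M) : lpoly (semidirect M) :=
  lpair (cmul x.1 y.1) (lact x.1 y.2 + ract x.2 y.1).

Let mcoeff_mul x y k : (semidirect_mul x y)@_k =
  ((cmul x.1 y.1)@_k, (lact x.1 y.2)@_k + (ract x.2 y.1)@_k).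
Proof. by rewrite [LHS]mcoeff_lpair mcoeffD. Qed.

Fact semidirect_sesquilinear : conformal_sesquilinear semidirect_mul.
Proof.
have [[cDl cZl cDr cZr] [cXl cXr]] := @cmul_sesquilinear K A.
have [[lDl lZl lDr lZr] [lXl lXr]] := @lact_sesquilinear K A M.
have [[rDl rZl rDr rZr] [rXl rXr]] := @ract_sesquilinear K A M.
split; split.
- move=> [a m] [a' m'] [b n]; apply/malgP => k.
  by rewrite mcoeffD !mcoeff_mul /= cDl lDl rDl !mcoeffD addrACA.
- move=> c [a m] [b n]; apply/malgP => k.
  rewrite mcoeff_lmap ?scaler0 // !mcoeff_mul /= cZl lZl rZl.
  by rewrite !mcoeff_lmap ?scaler0 // -scalerDr.
- move=> [a m] [b n] [b' n']; apply/malgP => k.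
  by rewrite mcoeffD !mcoeff_mul /= cDr lDr rDr !mcoeffD addrACA.
- move=> c [a m] [b n]; apply/malgP => k.
  rewrite mcoeff_lmap ?scaler0 // !mcoeff_mul /= cZr lZr rZr.
  by rewrite !mcoeff_lmap ?scaler0 // -scalerDr.
- move=> [a m] [b n]; apply/malgP => k.
  rewrite mcoeffN mcoeff_lshift !mcoeff_mul /= cXl lXl rXl.
  rewrite !mcoeffN !mcoeff_lshift -opprD.
  by case: k => [|k]; rewrite ?mcoeff_mul //= addr0.
- move=> [a m] [b n]; apply/malgP => k.
  rewrite [RHS]mcoeffD mcoeff_lshift mcoeff_lmap ?scaler0 // !mcoeff_mul /=.
  rewrite cXr lXr rXr !mcoeffD !mcoeff_lmap ?scaler0 // !mcoeff_lshift.
  rewrite addrACA -scalerDr.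
  by case: k => [|k]; rewrite ?mcoeff_mul ?addr0.
Qed.

Fact semidirect_mulA :
  conformal_associative semidirect_mul semidirect_mul
                        semidirect_mul semidirect_mul.
Proof.
have s0l := sesq0l semidirect_sesquilinear.
have s0r := sesq0r semidirect_sesquilinear.
have c0l := sesq0l (@cmul_sesquilinear K A).
have c0r := sesq0r (@cmul_sesquilinear K A).
have l0l := sesq0l (@lact_sesquilinear K A M).
have l0r := sesq0r (@lact_sesquilinear K A M).
have r0l := sesq0l (@ract_sesquilinear K A M).
have r0r := sesq0r (@ract_sesquilinear K A M).
have [[_ _ lDr _] _] := @lact_sesquilinear K A M.
have [[rDl _ _ _] _] := @ract_sesquilinear K A M.
move=> [a m] [b n] [c p]; apply/malgP => j; apply/malgP => s.
rewrite mcoeff_lmap_add // mcoeff_lmap // !mcoeff_mul /= lDr mcoeffD.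
have := congr1 (fun q : lpoly (lpoly A) => q@_j@_s) (cmulA a b c).
rewrite mcoeff_lmap_add // mcoeff_lmap // => <-.
have := congr1 (fun q : lpoly (lpoly M) => q@_j@_s) (lactA a b p).
rewrite mcoeff_lmap_add // mcoeff_lmap // => <-.
have := congr1 (fun q : lpoly (lpoly M) => q@_j@_s) (ractA m b c).
rewrite mcoeff_lmap_add // mcoeff_lmap // => <-.
have := congr1 (fun q : lpoly (lpoly M) => q@_j@_s) (lractA a n c).
rewrite mcoeff_lmap_add // mcoeff_lmap // => <-.
rewrite -!big_split /=.
rewrite [LHS]surjective_pairing; congr pair; rewrite raddf_sum /=.
  by apply: eq_bigr => i _; rewrite !mcoeff_mul raddfMn.
apply: eq_bigr => i _; rewrite !mcoeff_mul raddfMn /= rDl.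
by rewrite mcoeffD !mulrnDl addrA.
Qed.

HB.instance Definition _ := Lmodule_isAssocConformal.Build K (semidirect M)
  semidirect_sesquilinear semidirect_mulA.

Definition graph (T : M -> A) : set (semidirect M) :=
  range (fun m => (T m, m)).

End Semidirect.

(* Main.v *)
Require Import Defs.
From HB Require Import structures.
From mathcomp Require Import all_boot all_order all_algebra.
From mathcomp Require Import finmap boolp classical_sets reals.
From mathcomp Require Import complex monalg.

Import GRing.Theory.
Local Open Scope ring_scope.

(** The graph is a submodule because [T] is linear, so only closure under the product matters. The
    semidirect product of [(T m, m)] and [(T n, n)] has first component [T(m)_λ T(n)] and second
    component [T(m)_λ n + m_λ T(n)]. By [mem_graph], its coefficients lie in the graph exactly when
    [T] sends those of the second to those of the first, which is the O-operator identity at [m],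
    [n] read coefficient by coefficient. *)

(** [monalgOver] constrains only coefficients on the support; the others are 0, whence the
    hypothesis on [S]. *)
Lemma lpoly_overP (W : zmodType) (S : {pred W}) (p : lpoly W) : 0 \in S ->
  reflect (forall k, p@_k \in S) (p \is a monalgOver S).
Proof.
move=> S0; apply: (iffP allP) => /= pS k; last by rewrite pS.
by case: msuppP => // /pS.
Qed.

Section Graph.
Variables (K : fieldType) (A : assocConformalType K) (M : conformalBimodType A).

Lemma mcoeff_semidirect_mul (x y : semidirect M) k :
  (cmul x y)@_k =
  ((cmul x.1 y.1)@_k, (lact x.1 y.2 + ract x.2 y.1)@_k).
Proof. exact: mcoeff_lpair. Qed.

Lemma mem_graph (T : M -> A) (x : semidirect M) :
  (x \in graph T) = (x.1 == T x.2).
Proof.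
apply/idP/eqP => [|xT]; first by rewrite inE => -[m _ <-].
by rewrite inE; exists x.2 => //; rewrite -xT -surjective_pairing.
Qed.

(** Variant of [mem_graph] for rewriting in the predicate form used by [submod_closed] and
    [monalgOver]. *)
Lemma in_graph (T : M -> A) (x : semidirect M) :
  (x \in [in graph T]) = (x.1 == T x.2).
Proof. exact: mem_graph. Qed.

Lemma graph_submod_closed (T : {linear M -> A}) :
  submod_closed [in graph T].
Proof.
split=> [|a x y]; rewrite !in_graph; first by apply/eqP; rewrite [RHS]raddf0.
by move=> /eqP xT /eqP yT; apply/eqP; rewrite /= xT yT linearP.
Qed.

End Graph.

Theorem proposition3p2 (R : realType) (A : assocConformalType R[i])
    (M : conformalBimodType A) (T : {linear M -> A}) :
  O_operator T <-> conformal_subalgebra (graph T).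
Proof.
have graph0 : 0 \in [in graph T] by have [] := graph_submod_closed _ _ _ T.
split=> [TO|[_ Tmul] m n].
  split=> [|x y]; first exact: graph_submod_closed.
  rewrite !mem_graph => /eqP xT /eqP yT; apply/lpoly_overP => // k.
  rewrite in_graph mcoeff_semidirect_mul /= xT yT TO.
  (* [lmap] gives 0 off the support, so its coefficients are images under [T] everywhere only
     because [T 0 = 0]. *)
  by rewrite mcoeff_lmap ?raddf0.
apply/malgP => k; rewrite mcoeff_lmap ?raddf0 //.
have Tgraph p : ((T p, p) : semidirect M) \in graph T.
  by rewrite mem_graph.
(* Closure is tested on the graph points over [m] and [n]; coefficient [k] of their product yields
   the identity in degree [k]. *)
have /(lpoly_overP _ _ _ graph0)/(_ k) := Tmul _ _ (Tgraph m) (Tgraph n).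
by rewrite in_graph mcoeff_semidirect_mul => /eqP.
Qed.
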